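(* Let $q$ be a prime power, $n\ge 2$, let $\Sigma=\{\langle (x,x^{q},\ldots,x^{q^{n-1}})\rangle_{\mathbb{F}_{q^n}} : x\in\mathbb{F}_{q^n}^*\}$ in $\mathrm{PG}(n-1,q^n)$, and let $\sigma$ be a collineation of $\mathrm{PG}(n-1,q^n)$ whose set of fixed points is exactly $\Sigma$. Let $\Gamma$ be a projective subspace of $\mathrm{PG}(n-1,q^n)$ of dimension $k\ge 0$ such that $\Gamma\cap\Sigma=\emptyset$ and $\dim(\Gamma\cap\Gamma^{\sigma})\ge k-2$. Let $r$ be the least positive integer satisfying \[\dim(\Gamma\cap\Gamma^{\sigma}\cap\Gamma^{\sigma^2}\cap\cdots\cap\Gamma^{\sigma^r})>k-2r .\] Then there is a point $P\in\mathrm{PG}(n-1,q^n)$ such that (i) $P,P^{\sigma},\ldots,P^{\sigma^{k-r+1}}$ are independent points contained in $\Gamma$; (ii) $P^{\sigma^{n-1}}\notin\Gamma$. If $r<(k+2)/2$, then the point $P$ satisfying (i) and (ii) is unique.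
   Context: $\mathrm{PG}(n-1,q^n)$ has homogeneous coordinates $x_0,\ldots,x_{n-1}$; $\Sigma\cong\mathrm{PG}(n-1,q)$ is a canonical subgeometry. The collineations with fixed point set exactly $\Sigma$ are the powers $\hat\sigma^s$, $\gcd(s,n)=1$, of $\hat\sigma:\langle(x_0,\ldots,x_{n-1})\rangle_{\mathbb{F}_{q^n}}\mapsto\langle(x_{n-1}^q,x_0^q,\ldots,x_{n-2}^q)\rangle_{\mathbb{F}_{q^n}}$. Dimensions are projective, the empty subspace has dimension $-1$, and $S^{\sigma}$ denotes the image of $S$ under $\sigma$. The integer $r$ is called the intersection number $\mathrm{intn}_\sigma(\Gamma)$ of $\Gamma$ with respect to $\sigma$. *)

(* Defs.v *)
From HB Require Import structures.
From mathcomp Require Import all_boot all_order all_algebra.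

Set Implicit Arguments.
Unset Strict Implicit.
Unset Printing Implicit Defensive.

Import Order.TTheory GRing.Theory Num.Theory.
Local Open Scope ring_scope.

Definition prime_power (q : nat) : Prop :=
  exists p m : nat, [/\ prime p, (0 < m)%N & q = (p ^ m)%N].

(* A projective subspace of PG(n-1, F) is represented by the underlying vector
   subspace of F^n; its projective dimension is -1 for the empty subspace. *)
Notation pspace F n := {vspace 'rV[F]_n}.

Definition pdim (F : fieldType) (n : nat) (U : pspace F n) : int :=
  (\dim U)%:Z - 1.

Definition is_point (F : fieldType) (n : nat) (P : pspace F n) : Prop :=
  pdim P = 0.

(* A collineation is an element of PGammaL(n, F), seen through its action on
   all subspaces: the map induced by a bijective theta-semilinear map f for
   some field automorphism theta. For n = 2, where preservation of
   incidence is an empty condition, this is the usual convention. *)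
Definition is_collineation (F : finFieldType) (n : nat)
    (sigma : pspace F n -> pspace F n) : Prop :=
  exists (theta : {rmorphism F -> F})
         (f : {linear 'rV[F]_n -> 'rV[F]_n | theta \; *:%R}),
    [/\ bijective theta, bijective f
      & forall U : pspace F n, sigma U =i [set f v | v in U]].

(* The points <(x, x^q, ..., x^(q^(n-1)))>, x != 0. *)
Definition in_Sigma (F : fieldType) (n q : nat) (P : pspace F n) : Prop :=
  exists2 x : F, x != 0 & P = <[\row_(i < n) x ^+ (q ^ i)]>%VS.

Definition fixed_points_are (F : fieldType) (n : nat)
    (sigma : pspace F n -> pspace F n) (S : pspace F n -> Prop) : Prop :=
  forall P : pspace F n, is_point P -> (sigma P = P <-> S P).

(* Gamma :&: Gamma^sigma :&: ... :&: Gamma^(sigma^s). *)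
Definition cap_iter (F : fieldType) (n : nat)
    (sigma : pspace F n -> pspace F n) (Gamma : pspace F n) (s : nat)
    : pspace F n :=
  (\bigcap_(i < s.+1) iter i sigma Gamma)%VS.

Definition intn_cond (F : fieldType) (n : nat)
    (sigma : pspace F n -> pspace F n) (Gamma : pspace F n) (s : nat) : Prop :=
  pdim Gamma - s.*2%:Z < pdim (cap_iter sigma Gamma s).

Definition is_intn (F : fieldType) (n : nat)
    (sigma : pspace F n -> pspace F n) (Gamma : pspace F n) (r : nat) : Prop :=
  [/\ (0 < r)%N, intn_cond sigma Gamma r
    & forall s : nat, (0 < s)%N -> intn_cond sigma Gamma s -> (r <= s)%N].

Definition independent_points (F : fieldType) (n m : nat)
    (P : 'I_m -> pspace F n) : Prop :=
  (forall i, is_point (P i)) /\ directv (\sum_(i < m) P i)%VS.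

(* The exponent i of P^(sigma^i) runs over 0, ..., k - r + 1, that is i < k + 2 - r;
   the least r (see is_intn) satisfies r <= k + 1, so nothing is truncated. *)
Definition good_point (F : fieldType) (n : nat)
    (sigma : pspace F n -> pspace F n) (Gamma : pspace F n) (k r : nat)
    (P : pspace F n) : Prop :=
  [/\ is_point P,
      independent_points (fun i : 'I_(k + 2 - r) => iter i sigma P),
      (forall i : 'I_(k + 2 - r), (iter i sigma P <= Gamma)%VS)
    & ~ (iter n.-1 sigma P <= Gamma)%VS].

(* Main.v *)
(* The collineation sigma is induced by a theta-semilinear map f which scales a basis
   of vectors representing points of Sigma by a common factor lam; theta fixes F_q, so
   sigma^n = 1. A nonzero sigma-invariant subspace contains a point of Sigma, so no
   nonzero subspace of Gamma is invariant. Let G_s be the intersection of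
   Gamma, ..., Gamma^(sigma^s). The dimensions of the G_s form a convex sequence that
   decreases strictly until it reaches 0, with steps 2 before index r - 1 and steps at
   most 1 from there on. Hence G_(k-r+1) contains a point Q while G_(k-r+2) is empty, and
   P is the preimage of Q under sigma^(k-r+1): if P^(sigma^(n-1)) = P^(sigma^(-1)) were in
   Gamma, then Q would lie in G_(k-r+2). For r < (k+2)/2, G_(k-r+1) is a single point. *)
Require Import Defs.
From HB Require Import structures.
From mathcomp Require Import all_boot all_order all_algebra.
From mathcomp Require Import cyclic finfield zify.

Set Implicit Arguments.
Unset Strict Implicit.
Unset Printing Implicit Defensive.

Import Order.TTheory GRing.Theory Num.Theory.
Local Open Scope ring_scope.

(** * Primitive elements of finite fields *)

Lemma finField_prim_root (F : finFieldType) :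
  exists a : F, #|F|.-1.-primitive_root a.
Proof.
have F1 := finNzRing_gt1 F.
suff: has #|F|.-1.-primitive_root [seq x <- enum F | x != 0].
  by case/hasP=> a _ ?; exists a.
have F0 : (0 < #|F|.-1)%N by rewrite -ltnS prednK // ltnW.
apply: has_prim_root => //.
- apply/allP=> x; rewrite mem_filter => /andP[x0 _]; rewrite unity_rootE.
  by apply/eqP; apply: (mulfI x0); rewrite -exprS prednK ?expf_card ?mulr1 // ltnW.
- by rewrite filter_uniq // enum_uniq.
- rewrite size_filter -sum1_count big_enum_cond /= sum1_card.
  by rewrite -(cardC1 (0 : F)) //; apply: eq_leq; apply: eq_card => x; rewrite !inE.
Qed.

Lemma prim_root_neq0 (F : fieldType) (m : nat) (a : F) :
  m.-primitive_root a -> a != 0.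
Proof.
move=> ha; apply/eqP=> a0; have := prim_expr_order ha.
by rewrite a0 expr0n gtn_eqF ?(prim_order_gt0 ha) // => /eqP; rewrite eq_sym oner_eq0.
Qed.

(** * Vectors representing Sigma, and automorphisms fixing F_q *)

Section CanonicalSubgeometry.

Variables (F : finFieldType) (q n : nat).
Hypotheses (hq : prime_power q) (hn : (2 <= n)%N) (hF : #|F| = (q ^ n)%N).

(** Membership of [c] in F_q is expressed below by [c ^+ q = c]; the map is F_q-linear. *)
Definition sigma_vec (x : F) : 'rV[F]_n := \row_(i < n) x ^+ (q ^ i).

Lemma prime_power_gt1 : (1 < q)%N.
Proof.
case: hq => p [m [p_pr m0 ->]].
by rewrite -(exp1n m) ltn_exp2r // prime_gt1.
Qed.

Lemma exprD_qpow (i : nat) (x y : F) :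
  (x + y) ^+ (q ^ i) = x ^+ (q ^ i) + y ^+ (q ^ i).
Proof.
case: hq => p [m [p_pr m0 qE]].
have hp : p \in [pchar F] by apply: (@card_finPcharP _ _ (m * n)) => //; rewrite hF qE expnM.
apply: exprDn_pchar; rewrite (eq_pnat _ (pcharf_eq hp)) qE !pnatX.
by rewrite pnat_id.
Qed.

Lemma expr0_qpow (i : nat) : (0 : F) ^+ (q ^ i) = 0.
Proof. by rewrite expr0n gtn_eqF // expn_gt0 (ltnW prime_power_gt1). Qed.

Lemma sigma_vecD (x y : F) : sigma_vec (x + y) = sigma_vec x + sigma_vec y.
Proof. by apply/rowP=> i; rewrite !mxE exprD_qpow. Qed.

Lemma expr_qfixed (c : F) (i : nat) : c ^+ q = c -> c ^+ (q ^ i) = c.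
Proof. by move=> hc; elim: i => [|i IH]; rewrite ?expr1 // expnS exprM hc. Qed.

Lemma sigma_vecM (c x : F) : c ^+ q = c -> sigma_vec (c * x) = c *: sigma_vec x.
Proof. by move=> hc; apply/rowP=> i; rewrite !mxE exprMn (expr_qfixed i hc). Qed.

Lemma sigma_vec_neq0 (x : F) : x != 0 -> sigma_vec x != 0.
Proof.
move=> x0; apply/eqP => /rowP/(_ (Ordinal (ltnW hn))); rewrite !mxE /= expr1.
exact/eqP.
Qed.

Section PrimitiveElement.

Variable (a : F).
Hypothesis (ha : #|F|.-1.-primitive_root a).

(** The rows represent the points of Sigma with parameters 1, a, ..., a^(n-1); the determinant is a
    product of differences of conjugates of [a]. *)
Definition sigma_basis : 'M[F]_n := Vandermonde n (sigma_vec a).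

Lemma row_sigma_basis (i : 'I_n) : row i sigma_basis = sigma_vec (a ^+ i).
Proof. by apply/rowP=> j; rewrite !mxE exprAC. Qed.

(** Since q^n >= 2 q^(n-1) and q^(n-1) >= 2, the exponents stay below the order q^n - 1 of [a]. *)
Lemma prim_qpow_inj (i j : 'I_n) : a ^+ (q ^ i) = a ^+ (q ^ j) -> i = j.
Proof.
have q1 := prime_power_gt1.
have small (l : 'I_n) : (q ^ l < #|F|.-1)%N.
  have le_l : (q ^ l <= q ^ n.-1)%N by rewrite leq_exp2l // -ltnS prednK ?(ltnW hn) ?ltn_ord.
  have : (2 * q ^ n.-1 <= q ^ n)%N.
    by rewrite -[in leqRHS](prednK (ltnW hn)) expnS leq_mul2r q1 orbT.
  have : (2 ^ 1 <= q ^ n.-1)%N.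
    by apply: leq_trans (_ : (q ^ 1 <= _)%N); rewrite ?leq_exp2l // -ltnS prednK // ltnW.
  rewrite hF; lia.
move/eqP; rewrite (eq_prim_root_expr ha) !modn_small // eqn_exp2l // => /eqP.
exact: val_inj.
Qed.

Lemma sigma_basis_unit : sigma_basis \in unitmx.
Proof.
rewrite unitmxE det_Vandermonde unitfE.
apply/prodf_neq0 => i _; apply/prodf_neq0 => j ltij.
rewrite !mxE subr_eq0; apply: contraTneq ltij => /prim_qpow_inj->.
by rewrite ltnn.
Qed.

Lemma finField_exprE (x : F) : x != 0 -> exists k : nat, x = a ^+ k.
Proof.
move=> x0; have [|k ->] := prim_rootP ha (x := x); last by exists k.
by apply: (mulfI x0); rewrite -exprS prednK ?expf_card ?mulr1 // ltnW ?finNzRing_gt1.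
Qed.

Lemma qFrobenius_rmorphism : exists phi : {rmorphism F -> F}, forall x, phi x = x ^+ q.
Proof.
case: hq => p [m [p_pr m0 qE]].
have hp : p \in [pchar F] by apply: (@card_finPcharP _ _ (m * n)) => //; rewrite hF qE expnM.
rewrite qE; elim: {m0 qE} m => [|m [phi phiE]]; first by exists idfun => x; rewrite expr1.
by exists (pFrobenius_aut hp \o phi) => x; rewrite /= phiE pFrobenius_autE -exprM -expnSr.
Qed.

Variable theta : {rmorphism F -> F}.
Hypothesis theta_fix : forall c : F, c ^+ q = c -> theta c = c.

(* The polynomial with roots the F_q-conjugates of a is fixed by theta, which therefore
   permutes these conjugates: theta is a power of the q-Frobenius. *)
Lemma rmorphism_qpow : exists i : nat, forall x, theta x = x ^+ (q ^ i).
Proof.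
have [phi phiE] := qFrobenius_rmorphism.
pose P := \prod_(i < n) ('X - (a ^+ (q ^ i))%:P).
(* [phi] moves each factor to the next, and the last to the first because a^(q^n) = a. *)
have phiP : map_poly phi P = P.
  rewrite /P map_prod_XsubC; case: (n) hF => [|m] hFm; first by rewrite !big_ord0.
  rewrite big_ord_recr big_ord_recl /= mulrC expr1 phiE -exprM -expnSr -hFm expf_card.
  by congr (_ * _); apply: eq_bigr => i _; rewrite phiE -exprM -expnSr.
have thetaP : map_poly theta P = P.
  apply/polyP=> k; rewrite coef_map /=; apply: theta_fix.
  by rewrite -phiE -[in RHS]phiP coef_map.
have : root P (theta a).
  rewrite -thetaP fmorph_root /P (bigD1 (Ordinal (ltnW hn))) //= expr1.
  by rewrite rootM root_XsubC eqxx.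
rewrite /P -(big_map (fun i : 'I_n => a ^+ (q ^ i)) xpredT (fun c => 'X - c%:P)).
rewrite root_prod_XsubC => /mapP[i _ thetaa]; exists i => x.
have [->|/finField_exprE[k ->]] := eqVneq x 0; first by rewrite rmorph0 expr0_qpow.
by rewrite rmorphXn /= thetaa exprAC.
Qed.

(** If [theta] raises to the power q^i, its n-th iterate raises to the power (q^n)^i, a power of
    [#|F|]. *)
Lemma iter_rmorphism (x : F) : iter n theta x = x.
Proof.
have [i thetaE] := rmorphism_qpow.
have iterE k : iter k theta x = x ^+ (q ^ (i * k)).
  elim: k => [|k IH]; first by rewrite muln0.
  by rewrite iterS IH thetaE -exprM -expnD mulnS addnC.
rewrite iterE mulnC expnM -hF; elim: (i) => // k IH.
by rewrite expnS exprM expf_card.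
Qed.

End PrimitiveElement.
End CanonicalSubgeometry.

(** * Semilinear maps scaling a basis by a common factor *)

Section SemilinearFrame.

Variables (F : finFieldType) (n : nat) (theta : {rmorphism F -> F}).
Variable f : {linear 'rV[F]_n -> 'rV[F]_n | theta \; *:%R}.
Variables (B : 'M[F]_n) (lam : F).
Hypotheses (B_unit : B \in unitmx) (lam0 : lam != 0).
Hypothesis f_row : forall i, f (row i B) = lam *: row i B.

Lemma semilinear_coord (c : 'rV[F]_n) : f (c *m B) = lam *: (map_mx theta c *m B).
Proof.
rewrite !mulmx_sum_row linear_sum scaler_sumr; apply: eq_bigr => i _.
by rewrite linearZ_LR /= f_row !mxE !scalerA mulrC.
Qed.

(** In the coordinates of [B], the m-th iterate is theta^m entrywise times the product of the
    theta^j(lam), j < m. *)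
Lemma iter_semilinear (m : nat) : (forall x, iter m theta x = x) ->
  exists2 mu : F, mu != 0 & forall v, iter m f v = mu *: v.
Proof.
move=> theta_m.
have [mu mu0 iterE] : exists2 mu : F, mu != 0 &
    forall c : 'rV_n, iter m f (c *m B) = mu *: (map_mx (iter m theta) c *m B).
  elim: {theta_m} m => [|m [mu mu0 IH]].
    exists 1; rewrite ?oner_eq0 // => c; rewrite scale1r; congr (_ *m _).
    by apply/rowP=> i; rewrite mxE.
  exists (theta mu * lam) => [|c]; first by rewrite mulf_neq0 ?fmorph_eq0.
  rewrite iterS IH linearZ_LR /= semilinear_coord scalerA; congr (_ *: (_ *m _)).
  by apply/rowP=> i; rewrite !mxE.
exists mu => // v; rewrite -[v](mulmxKV B_unit) iterE; congr (_ *: (_ *m _)).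
by apply/rowP=> i; rewrite mxE theta_m.
Qed.

(* Normalize one coordinate of a vector u of minimal weight to 1: then f u - lam u
   lies in U and has smaller weight, hence vanishes. *)
Lemma invariant_fixed_line (U : pspace F n) :
  U != 0%VS -> (forall v, v \in U -> f v \in U) ->
  exists u, [/\ u != 0, u \in U & f u = lam *: u].
Proof.
move=> U0 fU; pose wt (c : 'rV[F]_n) := #|[set i | c 0 i != 0]|.
pose good (c : 'rV[F]_n) := (c != 0) && (c *m B \in U).
have [c0 c0P] : exists c, good c.
  exists (vpick U *m invmx B); rewrite /good mulmxKV // memv_pick andbT.
  apply: contraNneq U0 => E; rewrite -vpick0; apply/eqP.
  by rewrite -[vpick U](mulmxKV B_unit) E mul0mx.
case: (arg_minnP wt c0P) => c /andP[cn0 cU] cmin.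
have /rV0Pn[j cj] := cn0.
pose d := (c 0 j)^-1 *: c.
have dU : d *m B \in U by rewrite -scalemxAl memvZ.
have dj : d 0 j = 1 by rewrite mxE mulVf.
pose e := map_mx theta d - d.
have eU : e *m B \in U.
  rewrite mulmxBl rpredB // -[_ *m B](scalerK lam0) -semilinear_coord.
  by rewrite memvZ // fU.
have e0 : e = 0.
  apply/eqP; apply: contraT => en0; have := cmin e; rewrite /good en0 eU => /(_ isT).
  (* The support of [e] lies in that of [c] as theta 0 = 0, and misses [j] as theta 1 = 1. *)
  rewrite leqNgt; case/negP; apply: proper_card; apply/properP; split.
    apply/subsetP=> i; rewrite !inE; apply: contraNneq => ci.
    by rewrite !mxE ci mulr0 rmorph0 subrr.
  by exists j; rewrite !inE // !mxE mulVf // rmorph1 subrr eqxx.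
exists (d *m B); split=> //.
  apply: contraNneq (oner_neq0 F) => dB; rewrite -dj.
  by rewrite -[d](mulmxK B_unit) dB mul0mx mxE.
by rewrite semilinear_coord; congr (_ *: (_ *m _)); apply/eqP; rewrite -subr_eq0 -/e e0.
Qed.

End SemilinearFrame.

(** * Action of a collineation on the subspace lattice *)

Section Collineation.

Variables (F : finFieldType) (n : nat) (theta : {rmorphism F -> F}).
Variable f : {linear 'rV[F]_n -> 'rV[F]_n | theta \; *:%R}.
Variable sigma : pspace F n -> pspace F n.
Hypothesis f_inj : injective f.
Hypothesis sigmaE : forall U : pspace F n, sigma U =i [set f v | v in U].

Lemma mem_collineation (U : pspace F n) v : (f v \in sigma U) = (v \in U).
Proof. by rewrite sigmaE mem_imset. Qed.

Lemma collineationP (U : pspace F n) w :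
  reflect (exists2 v, v \in U & w = f v) (w \in sigma U).
Proof. by rewrite sigmaE; apply: imsetP. Qed.

(** As [f] is only semilinear, dimensions are compared by counting vectors. *)
Lemma dim_collineation (U : pspace F n) : \dim (sigma U) = \dim U.
Proof.
have F1 := finNzRing_gt1 F.
have := card_vspace (sigma U); rewrite (eq_card (sigmaE U)) card_imset // card_vspace.
by move/eqP; rewrite eqn_exp2l // => /eqP.
Qed.

Lemma collineation_line v : sigma <[v]>%VS = <[f v]>%VS.
Proof.
apply/esym/eqP; rewrite eqEdim -memvE mem_collineation memv_line dim_collineation.
by rewrite !dim_vline -(inj_eq f_inj v 0) linear0 leqnn.
Qed.

Lemma collineationS (U V : pspace F n) : (sigma U <= sigma V)%VS = (U <= V)%VS.
Proof.
apply/subvP/subvP=> sUV w; first by rewrite -mem_collineation => /sUV; rewrite mem_collineation.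
by case/collineationP=> v /sUV vV ->; rewrite mem_collineation.
Qed.

Lemma collineation_cap (U V : pspace F n) :
  sigma (U :&: V)%VS = (sigma U :&: sigma V)%VS.
Proof.
apply/vspaceP=> w; rewrite memv_cap; apply/collineationP/andP.
  by case=> v; rewrite memv_cap => /andP[vU vV] ->; rewrite !mem_collineation.
case=> /collineationP[v vU ->]; rewrite mem_collineation => vV.
by exists v; rewrite // memv_cap vU.
Qed.

Lemma collineation_full : sigma fullv = fullv.
Proof. by apply/eqP; rewrite eqEdim subvf dim_collineation leqnn. Qed.

Lemma collineation_add (U V : pspace F n) :
  sigma (U + V)%VS = (sigma U + sigma V)%VS.
Proof.
apply/vspaceP=> w; apply/collineationP/memv_addP.
  case=> v /memv_addP[u uU [u' u'V ->]] ->.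
  exists (f u); rewrite ?mem_collineation //.
  by exists (f u'); rewrite ?mem_collineation // linearD.
case=> _ /collineationP[u uU ->] [_ /collineationP[v vV ->] ->].
by exists (u + v); rewrite ?linearD ?memv_add.
Qed.

Lemma mem_iter_collineation (m : nat) (U : pspace F n) v :
  v \in U -> iter m f v \in iter m sigma U.
Proof. by move=> vU; elim: m => //= m IH; rewrite mem_collineation. Qed.

End Collineation.

(** * The frame determined by the fixed points *)

Section FixedSubgeometry.

Variables (F : finFieldType) (q n : nat).
Hypotheses (hq : prime_power q) (hn : (2 <= n)%N) (hF : #|F| = (q ^ n)%N).
Variable theta : {rmorphism F -> F}.
Variable f : {linear 'rV[F]_n -> 'rV[F]_n | theta \; *:%R}.
Hypothesis f_inj : injective f.
Hypothesis f_line : forall x : F, x != 0 ->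
  exists mu : F, f (sigma_vec q n x) = mu *: sigma_vec q n x.
Variable a : F.
Hypothesis (ha : #|F|.-1.-primitive_root a).

Let B := sigma_basis q n a.

(** Fixing the basis points alone allows different factors; fixing the points of c e_0 + e_i as well
    forces a common one (c = 1), and then theta c = c for c in F_q. *)
Lemma fixed_subgeometry_frame :
  exists2 lam : F, lam != 0 &
    (forall i, f (row i B) = lam *: row i B) /\
    (forall c : F, c ^+ q = c -> theta c = c).
Proof.
have B_unit : B \in unitmx by exact: sigma_basis_unit.
have n0 : (0 < n)%N by apply: ltnW.
pose i0 := Ordinal n0; pose i1 := Ordinal hn.
have a0 : a != 0 := prim_root_neq0 ha.
have rowE i : row i B = sigma_vec q n (a ^+ i) := row_sigma_basis q a i.
have [lam0 f0] : exists mu : F, f (row i0 B) = mu *: row i0 B.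
  by rewrite rowE; apply: f_line; rewrite expf_neq0.
have lam0n0 : lam0 != 0.
  have r0 : row i0 B != 0 by rewrite rowE (sigma_vec_neq0 q hn) // expf_neq0.
  apply: contraNneq r0 => l0; apply/eqP/f_inj.
  by rewrite f0 l0 scale0r linear0.
have f_row i : exists mu : F, f (row i B) = mu *: row i B.
  by rewrite rowE; apply: f_line; rewrite expf_neq0.
(* c e_0 + e_i represents a point of Sigma too; compare the coordinates of its image. *)
have combine c i li : c ^+ q = c -> i != i0 -> f (row i B) = li *: row i B ->
    li * c = theta c * lam0.
  move=> hc ii0 fi.
  have vecE : sigma_vec q n (c + a ^+ i) = (c *: delta_mx 0 i0 + delta_mx 0 i) *m B.
    rewrite mulmxDl -scalemxAl -!matrix.rowE !rowE expr0 -(sigma_vecM _ _ hc) mulr1.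
    exact: (sigma_vecD hq hF).
  have coord (u v : 'rV_n) : u *m B = v *m B -> u = v by apply: can_inj (mulmxK B_unit) _ _.
  have ca0 : c + a ^+ i != 0.
    apply: contraNneq (oner_neq0 F) => E.
    have : sigma_vec q n (c + a ^+ i) = 0 *m B.
      by rewrite mul0mx; apply/rowP=> j; rewrite E !mxE (expr0_qpow F hq).
    rewrite vecE => /coord /rowP/(_ i); rewrite !mxE !eqxx.
    by rewrite (negPf ii0) /= mulr0 add0r => /eqP; rewrite oner_eq0.
  have [mu fE] := f_line ca0.
  have : ((theta c * lam0) *: delta_mx 0 i0 + li *: delta_mx 0 i : 'rV_n) *m B =
         (mu *: (c *: delta_mx 0 i0 + delta_mx 0 i)) *m B.
    rewrite -(scalemxAl mu) -vecE -fE vecE !mulmxDl -!scalemxAl -!matrix.rowE.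
    by rewrite linearD linearZ_LR /= f0 fi scalerA.
  move/coord/rowP=> E.
  have := E i; rewrite !mxE !eqxx (negPf ii0) /= !mulr0 !add0r !mulr1 => ->.
  by have := E i0; rewrite !mxE !eqxx [i0 == i]eq_sym (negPf ii0) /= !mulr0 !addr0 !mulr1.
have lamE i li : i != i0 -> f (row i B) = li *: row i B -> li = lam0.
  by move=> ii0 /(combine 1 i li (expr1n _ _) ii0); rewrite rmorph1 mul1r mulr1.
exists lam0 => //; split=> [i|c hc].
  have [->//|ii0] := eqVneq i i0.
  by have [li fi] := f_row i; rewrite fi (lamE i li).
(* A second basis vector, available because n >= 2, is needed to compare theta c with c. *)
have [li fi] := f_row i1; have i10 : i1 != i0 by [].
apply: (mulIf lam0n0); rewrite -(combine c i1 li) // (lamE i1 li) //.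
exact: mulrC.
Qed.

End FixedSubgeometry.

(** * Arithmetic of the dimension sequence *)

(** Used with [e s] the vector dimension of G_s and [d] = k + 1, so that [d - r] is the exponent k -
    r + 1. By convexity the steps never grow, and the first is at most 2. *)
Lemma convex_dim_seq (e : nat -> nat) (d r : nat) :
  (0 < d)%N -> e 0%N = d -> (d <= e 1 + 2)%N ->
  (forall s, (2 * e s.+1 <= e s.+2 + e s)%N) ->
  (forall s, (e s.+1 <= e s)%N) ->
  (forall s, (0 < e s)%N -> (e s.+1 < e s)%N) ->
  (0 < r)%N -> (d < e r + 2 * r)%N ->
  (forall s, (0 < s)%N -> (d < e s + 2 * s)%N -> (r <= s)%N) ->
  [/\ (r <= d)%N, (0 < e (d - r))%N, e (d - r).+1%N = 0%N &
      (2 * r <= d)%N -> e (d - r)%N = 1%N].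
Proof.
move=> d0 e0 e1 convex noninc decr r0 er rmin.
have drop2 s : (e s <= e s.+1 + 2)%N.
  by elim: s => [|s IH]; [rewrite e0 | have := convex s; lia].
have lower s : (d <= e s + 2 * s)%N.
  by elim: s => [|s IH]; [lia | have := drop2 s; lia].
(* Minimality of [r] turns the bound [lower] into an equality. *)
have early s : (s < r)%N -> e s = (d - 2 * s)%N /\ (2 * s <= d)%N.
  case: s => [|s] sr; first by rewrite e0; split; lia.
  have : ~~ (d < e s.+1 + 2 * s.+1)%N by apply/negP=> /(rmin s.+1 isT); lia.
  by have := lower s.+1; lia.
have [epred ?] : e r.-1 = (d - 2 * r.-1)%N /\ (2 * r.-1 <= d)%N by apply: early; lia.
(* The step from r - 1 to r is at most 1, by the value at r - 1 and the condition at [r]; convexity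
   propagates this. *)
have drop1 j : (e (r.-1 + j) <= e (r.-1 + j).+1 + 1)%N.
  elim: j => [|j IH]; first by rewrite addn0 prednK //; lia.
  by rewrite addnS; have := convex (r.-1 + j)%N; lia.
(* Truncated subtraction accounts for the sequence staying at 0. *)
have late j : e (r.-1 + j)%N = (d - 2 * r.-1 - j)%N.
  elim: j => [|j IH]; first by rewrite addn0 subn0.
  by rewrite addnS; have := drop1 j; have := noninc (r.-1 + j)%N; have := decr (r.-1 + j)%N; lia.
(* If 2r <= d + 1, the index d - r is at least r - 1, and the value there is 1. *)
have [r_small|r_big] := leqP (2 * r) d.+1.
  have E : (d - r = r.-1 + (d - 2 * r.-1 - 1))%N by lia.
  by split; [lia| rewrite E late; lia | rewrite E -addnS late; lia | rewrite E late; lia].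
(* Now 2r = d + 2, so d - r = r - 2: the last values are 2 at r - 2 and 0 at r - 1. *)
have [E1 _] : e (d - r)%N = (d - 2 * (d - r))%N /\ (2 * (d - r) <= d)%N by apply: early; lia.
split; [lia|lia| |lia].
have -> : (d - r).+1%N = r.-1 by lia.
by rewrite epred; lia.
Qed.

(** * The intersections G_s and orbits of points in Gamma *)

Section OrbitIntersections.

Variables (F : fieldType) (n : nat) (sigma : pspace F n -> pspace F n).
Hypothesis dim_sigma : forall U, \dim (sigma U) = \dim U.
Hypothesis sigmaS : forall U V, (sigma U <= sigma V)%VS = (U <= V)%VS.
Hypothesis sigma_cap : forall U V, sigma (U :&: V)%VS = (sigma U :&: sigma V)%VS.
Hypothesis sigma_add : forall U V, sigma (U + V)%VS = (sigma U + sigma V)%VS.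
Hypothesis sigma_full : sigma fullv = fullv.
Hypothesis n_gt0 : (0 < n)%N.
Hypothesis sigma_order : forall U, iter n sigma U = U.
Variable Gamma : pspace F n.
Hypothesis no_invariant : forall U, (U <= Gamma)%VS -> sigma U = U -> U = 0%VS.

Lemma iter_sigmaS m U V : (iter m sigma U <= iter m sigma V)%VS = (U <= V)%VS.
Proof. by elim: m => //= m <-; rewrite sigmaS. Qed.

Lemma iter_sigma_inj m : injective (iter m sigma).
Proof.
by move=> U V E; apply/eqP; rewrite eqEsubv -(iter_sigmaS m U) -(iter_sigmaS m V) E subvv.
Qed.

Lemma iter_sigma_surj m U : exists V, iter m sigma V = U.
Proof.
(* sigma^((n-1)m) inverts sigma^m because sigma^(nm) = 1. *)
exists (iter (n.-1 * m) sigma U); rewrite -iterD -mulSn prednK // mulnC.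
by elim: m => // m IH; rewrite mulSn iterD IH.
Qed.

Lemma dim_iter_sigma m U : \dim (iter m sigma U) = \dim U.
Proof. by elim: m => //= m <-. Qed.

Lemma sub_cap_iterP s U :
  reflect (forall i, (i <= s)%N -> (U <= iter i sigma Gamma)%VS)
          (U <= cap_iter sigma Gamma s)%VS.
Proof.
apply: (iffP subv_bigcapP) => [sU i le_is | sU i _]; last by apply: sU; rewrite -ltnS.
exact: (sU (Ordinal (le_is : i < s.+1)%N)).
Qed.

Lemma cap_iter0 : cap_iter sigma Gamma 0 = Gamma.
Proof. by rewrite /cap_iter big_ord1. Qed.

Lemma cap_iterSl s :
  cap_iter sigma Gamma s.+1 = (Gamma :&: sigma (cap_iter sigma Gamma s))%VS.
Proof. by rewrite /cap_iter big_ord_recl (big_morph _ sigma_cap sigma_full). Qed.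

Lemma cap_iter_decr s : (cap_iter sigma Gamma s.+1 <= cap_iter sigma Gamma s)%VS.
Proof. by apply/sub_cap_iterP => i le_is; apply: (sub_cap_iterP _ _ (subvv _)); apply: leqW. Qed.

Lemma cap_iterS s : cap_iter sigma Gamma s.+1 =
  (cap_iter sigma Gamma s :&: sigma (cap_iter sigma Gamma s))%VS.
Proof.
apply/eqP; rewrite eqEsubv subv_cap cap_iter_decr [X in (X <= sigma _)%VS]cap_iterSl capvSr /=.
by rewrite cap_iterSl capvS // -[X in (_ <= X)%VS](cap_iter0); apply/sub_cap_iterP => i;
  rewrite leqn0 => /eqP->; apply: (sub_cap_iterP _ _ (subvv _)).
Qed.

Local Notation e s := (\dim (cap_iter sigma Gamma s)).

(** This is the dimension formula for G_(s+1) and its image: they meet in G_(s+2), and their sum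
    lies in the image of G_s. *)
Lemma dim_cap_iter_convex s : (2 * e s.+1 <= e s.+2 + e s)%N.
Proof.
have := dimv_sum_cap (cap_iter sigma Gamma s.+1) (sigma (cap_iter sigma Gamma s.+1)).
rewrite -cap_iterS dim_sigma => E.
have : (cap_iter sigma Gamma s.+1 + sigma (cap_iter sigma Gamma s.+1)
        <= sigma (cap_iter sigma Gamma s))%VS.
  by rewrite subv_add sigmaS cap_iter_decr andbT cap_iterS capvSr.
by move/dimvS; rewrite dim_sigma; lia.
Qed.

Lemma cap_iter_subG s : (cap_iter sigma Gamma s <= Gamma)%VS.
Proof. exact: (sub_cap_iterP _ _ (subvv _) 0%N). Qed.

(** If G_(s+1) = G_s, then G_s lies in its image, hence is an invariant subspace of Gamma. *)
Lemma dim_cap_iter_decr s : (0 < e s)%N -> (e s.+1 < e s)%N.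
Proof.
rewrite ltnNge => e0; apply: contraNltn (e0) => le_e.
have EU : cap_iter sigma Gamma s.+1 = cap_iter sigma Gamma s.
  by apply/eqP; rewrite eqEdim cap_iter_decr.
rewrite (no_invariant (cap_iter_subG s)) ?dimv0 //.
by apply/esym/eqP; rewrite eqEdim dim_sigma leqnn -[X in (X <= _)%VS]EU cap_iterS capvSr.
Qed.

(** Applying sigma^(m-i) to the i-th inclusion reverses the order of the indices. *)
Lemma orbit_sub_cap_iter m P :
  (forall i, (i <= m)%N -> (iter i sigma P <= Gamma)%VS) <->
  (iter m sigma P <= cap_iter sigma Gamma m)%VS.
Proof.
split=> [sP | /sub_cap_iterP sP i le_im].
  apply/sub_cap_iterP => i le_im; rewrite -(subnKC le_im) iterD iter_sigmaS.
  by apply: sP; apply: leq_subr.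
have := sP (m - i)%N (leq_subr _ _).
by rewrite -{1}(subnK le_im) iterD iter_sigmaS.
Qed.

(* A dependency among the first points of the orbit would make their span
   sigma-invariant. *)
Lemma directv_orbit m P : \dim P = 1%N ->
  (forall i, (i < m)%N -> (iter i sigma P <= Gamma)%VS) ->
  directv (\sum_(i < m) iter i sigma P).
Proof.
move=> dimP sP.
rewrite directvE /= (eq_bigr (fun=> 1%N)) => [|i _]; last by rewrite dim_iter_sigma.
rewrite sum1_card card_ord; elim: m sP => [|m IH] sP; first by rewrite big_ord0 dimv0.
have /eqP dimS := IH (fun i lt_im => sP i (leqW lt_im)).
pose S := (\sum_(i < m) iter i sigma P)%VS.
have sSG : (S <= Gamma)%VS by apply/subv_sumP => i _; apply: sP; rewrite ltnS ltnW.
rewrite big_ord_recr /= -/S; have := dimv_sum_cap S (iter m sigma P).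
rewrite dimS dim_iter_sigma dimP => E.
suff : \dim (S :&: iter m sigma P) = 0%N by move=> C; move: E; rewrite C addn0 addn1 => ->.
apply/eqP; rewrite -leqn0 leqNgt; apply/negP=> C.
have sPS : (iter m sigma P <= S)%VS.
  have -> : iter m sigma P = (S :&: iter m sigma P)%VS; last exact: capvSl.
  by apply/esym/eqP; rewrite eqEdim capvSr dim_iter_sigma dimP.
have dim0 : sigma 0%VS = 0%VS by apply/eqP; rewrite -dimv_eq0 dim_sigma dimv0.
have S0 : S = 0%VS.
  apply: no_invariant => //; apply/eqP; rewrite eqEdim dim_sigma leqnn andbT.
  (* [sigma] moves each summand of [S] to the next, and the last to sigma^m P, which lies in [S]. *)
  rewrite /S (big_morph _ sigma_add dim0); apply/subv_sumP => i _.
  have := ltn_ord i; rewrite leq_eqVlt => /predU1P[im|im]; first by rewrite -iterS im.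
  by rewrite -iterS; apply: (sumv_sup (Ordinal im)).
by move: sPS; rewrite S0 subv0 -dimv_eq0 dim_iter_sigma dimP.
Qed.

Lemma orbit_point_exists m : (0 < e m)%N -> e m.+1 = 0%N ->
  exists P, [/\ \dim P = 1%N,
    forall i, (i <= m)%N -> (iter i sigma P <= Gamma)%VS &
    ~ (iter n.-1 sigma P <= Gamma)%VS].
Proof.
rewrite lt0n dimv_eq0 -vpick0 => v0 em.
have [P PE] := iter_sigma_surj m <[vpick (cap_iter sigma Gamma m)]>%VS.
have dimP : \dim P = 1%N by rewrite -(dim_iter_sigma m) PE dim_vline v0.
have sP : forall i, (i <= m)%N -> (iter i sigma P <= Gamma)%VS.
  by apply/orbit_sub_cap_iter; rewrite PE -memvE memv_pick.
exists P; split=> // sP'.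
have sigmaP' : sigma (iter n.-1 sigma P) = P by rewrite -iterS prednK.
(* The orbit of sigma^(n-1) P continues with P, ..., sigma^m P, so its first m + 2 points lie in
   Gamma. *)
have : (iter m.+1 sigma (iter n.-1 sigma P) <= cap_iter sigma Gamma m.+1)%VS.
  by apply/orbit_sub_cap_iter => -[|i] // le_im; rewrite iterSr sigmaP'; apply: sP.
by move/dimvS; rewrite em !dim_iter_sigma dimP.
Qed.

(** Both points are carried by sigma^m to the single point of G_m. *)
Lemma orbit_point_unique m P P' : e m = 1%N -> \dim P = 1%N -> \dim P' = 1%N ->
  (forall i, (i <= m)%N -> (iter i sigma P <= Gamma)%VS) ->
  (forall i, (i <= m)%N -> (iter i sigma P' <= Gamma)%VS) -> P = P'.
Proof.
move=> em dimP dimP' /orbit_sub_cap_iter sP /orbit_sub_cap_iter sP'.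
have eq_cap Q : \dim Q = 1%N -> (iter m sigma Q <= cap_iter sigma Gamma m)%VS ->
    iter m sigma Q = cap_iter sigma Gamma m.
  by move=> dimQ sQ; apply/eqP; rewrite eqEdim sQ em dim_iter_sigma dimQ.
exact: (@iter_sigma_inj m P P' (etrans (eq_cap P dimP sP) (esym (eq_cap P' dimP' sP')))).
Qed.

End OrbitIntersections.

(** * Consequences of Sigma being the fixed point set *)

Section FixedPointsSigma.

Variables (F : finFieldType) (q n : nat).
Hypotheses (hq : prime_power q) (hn : (2 <= n)%N) (hF : #|F| = (q ^ n)%N).
Variable sigma : pspace F n -> pspace F n.
Variable theta : {rmorphism F -> F}.
Variable f : {linear 'rV[F]_n -> 'rV[F]_n | theta \; *:%R}.
Hypothesis f_inj : injective f.
Hypothesis sigmaE : forall U : pspace F n, sigma U =i [set f v | v in U].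
Hypothesis hfix : fixed_points_are sigma (@in_Sigma F n q).

Lemma is_point_line (v : 'rV[F]_n) : v != 0 -> is_point <[v]>%VS.
Proof. by move=> v0; rewrite /is_point /pdim dim_vline v0. Qed.

Lemma fixed_line (x : F) : x != 0 ->
  exists mu : F, f (sigma_vec q n x) = mu *: sigma_vec q n x.
Proof.
move=> x0; apply/vlineP.
have <- : sigma <[sigma_vec q n x]>%VS = <[sigma_vec q n x]>%VS; last first.
  by rewrite (mem_collineation f_inj sigmaE) memv_line.
apply/(hfix (is_point_line (sigma_vec_neq0 q hn x0))).
by exists x.
Qed.

Lemma sigma_frame : exists (B : 'M[F]_n) (lam : F),
  [/\ B \in unitmx, lam != 0, forall i, f (row i B) = lam *: row i B &
      forall x, iter n theta x = x].
Proof.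
have [a ha] := finField_prim_root F.
have [lam lam0 [f_row theta_fix]] := fixed_subgeometry_frame hq hn hF f_inj fixed_line ha.
exists (sigma_basis q n a), lam; split=> //; first exact: sigma_basis_unit.
exact: (iter_rmorphism hq hn hF ha theta_fix).
Qed.

(** The n-th iterate of [f] is a nonzero scalar, and scalars preserve every subspace. *)
Lemma collineation_order (U : pspace F n) : iter n sigma U = U.
Proof.
have [B [lam [B_unit lam0 f_row theta_n]]] := sigma_frame.
have [mu mu0 iter_f] := iter_semilinear B_unit lam0 f_row theta_n.
apply/esym/eqP; rewrite eqEdim (dim_iter_sigma (dim_collineation f_inj sigmaE)) leqnn andbT.
apply/subvP=> v vU; rewrite -[v](scalerK mu0) -iter_f.
by apply: memvZ; apply: (mem_iter_collineation f_inj sigmaE).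
Qed.

(** An eigenvector in [U] spans a fixed point, which [hfix] puts in Sigma; [fixed_line] rests on the
    converse direction of [hfix]. *)
Lemma invariant_meets_Sigma (U : pspace F n) :
  U != 0%VS -> sigma U = U -> exists2 P, in_Sigma q P & (P <= U)%VS.
Proof.
move=> U0 sU; have [B [lam [B_unit lam0 f_row _]]] := sigma_frame.
have [v vU|u [u0 uU fu]] := invariant_fixed_line B_unit lam0 f_row U0.
  by rewrite -sU (mem_collineation f_inj sigmaE).
exists <[u]>%VS; last by rewrite -memvE.
apply/(hfix (is_point_line u0)); apply/eqP.
rewrite (collineation_line f_inj sigmaE) eqEdim fu !dim_vline scaler_eq0 (negPf lam0) u0 /=.
by rewrite -memvE memvZ ?memv_line.
Qed.

End FixedPointsSigma.

Theorem theorem2p3 (q n : nat) (F : finFieldType)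
    (hq : prime_power q) (hn : (2 <= n)%N) (hF : #|F| = (q ^ n)%N)
    (sigma : pspace F n -> pspace F n)
    (hsigma : is_collineation sigma)
    (hfix : fixed_points_are sigma (@in_Sigma F n q))
    (Gamma : pspace F n) (k : nat)
    (hk : pdim Gamma = k%:Z)
    (hdisj : forall P : pspace F n, in_Sigma q P -> ~ (P <= Gamma)%VS)
    (hdim : k%:Z - 2 <= pdim (Gamma :&: sigma Gamma)%VS)
    (r : nat) (hr : is_intn sigma Gamma r) :
  (exists P : pspace F n, good_point sigma Gamma k r P) /\
  ((r%:Q < (k%:Q + 2) / 2) ->
   exists! P : pspace F n, good_point sigma Gamma k r P).
Proof.
case: hsigma => theta [f [_ /bij_inj f_inj sigmaE]].
have dimS := dim_collineation f_inj sigmaE.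
have subS := collineationS f_inj sigmaE.
have capS := collineation_cap f_inj sigmaE.
have addS := collineation_add f_inj sigmaE.
have fullS := collineation_full f_inj sigmaE.
have orderS := collineation_order hq hn hF f_inj sigmaE hfix.
have n0 : (0 < n)%N := ltnW hn.
have no_inv U : (U <= Gamma)%VS -> sigma U = U -> U = 0%VS.
  move=> sUG sU; apply/eqP; apply: contraT => U0.
  have [P PS sPU] := invariant_meets_Sigma hq hn hF f_inj sigmaE hfix U0 sU.
  by case: (hdisj P PS); apply: subv_trans sUG.
have dimG : \dim Gamma = k.+1 by move: hk; rewrite /pdim; move: (\dim Gamma : nat) => d; lia.
(* The -1 in both projective dimensions cancels. *)
have condE s : intn_cond sigma Gamma s <->
    (k.+1 < \dim (cap_iter sigma Gamma s) + 2 * s)%N.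
  by rewrite /intn_cond /pdim dimG; move: (\dim (cap_iter sigma Gamma s)) => c; split; lia.
case: hr => r0 /condE hr rmin.
have [] := convex_dim_seq (e := fun s => \dim (cap_iter sigma Gamma s)) (d := k.+1) (r := r).
- by [].
- by rewrite cap_iter0.
- rewrite cap_iterSl // cap_iter0; move: hdim; rewrite /pdim.
  by move: (\dim (Gamma :&: sigma Gamma) : nat) => c; lia.
- exact: dim_cap_iter_convex.
- by move=> s; apply/dimvS/cap_iter_decr.
- exact: (dim_cap_iter_decr dimS capS).
- by [].
- by [].
- by move=> s s0 /condE; apply: rmin.
set m := (k.+1 - r)%N => rk em em1 em_eq1.
(* [m] is the last exponent, [m.+1] the number of points; [rk] rules out truncation. *)
have mE : (k + 2 - r)%N = m.+1 by rewrite /m; lia.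
have pointP (P : pspace F n) : is_point P <-> \dim P = 1%N.
  by rewrite /is_point /pdim; move: (\dim P : nat) => c; split; lia.
have goodP P : good_point sigma Gamma k r P <-> [/\ \dim P = 1%N,
    forall i, (i <= m)%N -> (iter i sigma P <= Gamma)%VS &
    ~ (iter n.-1 sigma P <= Gamma)%VS].
  rewrite /good_point mE; split=> [[/pointP dimP _ sP sP'] | [dimP sP sP']].
    by split=> // i le_im; apply: (sP (Ordinal (le_im : i < m.+1)%N)).
  have dir := directv_orbit dimS addS no_inv dimP (m := m.+1) sP.
  split=> //; first exact/pointP.
  - by split=> // i; apply/pointP; rewrite (dim_iter_sigma dimS).
  - by move=> i; apply: sP; rewrite -ltnS.
have [P /goodP PP] := orbit_point_exists dimS subS n0 orderS em em1.
split; first by exists P.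
move=> r_small; exists P; split=> // P' /goodP[dimP' sP' _].
(* For integers, r < (k+2)/2 means 2r <= k + 1, the condition in [em_eq1]. *)
have em_1 : \dim (cap_iter sigma Gamma m) = 1%N.
  apply: em_eq1; move: r_small; rewrite ltr_pdivlMr //.
  by rewrite -[2]/(2%:~R) -intrM -intrD ltr_int; lia.
case/goodP: PP => dimP sP _.
exact: (orbit_point_unique dimS subS em_1).
Qed.
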